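(* Assume that $f(\cdot;\xi)$ is $L$-smooth and convex for every realization of $\xi$, and let $w_*=\arg\min_wF(w)$. Then for all $w\in\mathbb{R}^d$, $$\mathbb{E}[\|\nabla f(w;\xi)\|^2]\le4L[F(w)-F(w_* )]+N,\qquad\text{where }N=2\mathbb{E}[\|\nabla f(w_*;\xi)\|^2].$$
   Context: $\xi$ is a random variable, $f(\cdot;\xi):\mathbb{R}^d\to\mathbb{R}$ is differentiable for every realization of $\xi$, $F(w)=\mathbb{E}[f(w;\xi)]$, and $\mathbb{E}[\nabla f(w;\xi)]=\nabla F(w)$ for every fixed $w\in\mathbb{R}^d$. The norm is Euclidean. $L$-smoothness of $f(\cdot;\xi)$ (with $L>0$ independent of the realization): $\|\nabla f(w;\xi)-\nabla f(w';\xi)\|\le L\|w-w'\|$ for all $w,w'$. Convexity of $f(\cdot;\xi)$: $f(w;\xi)-f(w';\xi)\ge\langle\nabla f(w';\xi),w-w'\rangle$ for all $w,w'$. *)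

(* Defs.v *)
From HB Require Import structures.
From mathcomp Require Export all_boot all_order all_algebra.
From mathcomp Require Export all_classical all_reals all_analysis.

Set Implicit Arguments.
Unset Strict Implicit.
Unset Printing Implicit Defensive.
Export Order.TTheory GRing.Theory Num.Theory.
Export numFieldNormedType.Exports.

Local Open Scope classical_set_scope.
Local Open Scope ring_scope.

Section euclidean.
Context {R : realType} {d : nat}.

Definition inner (u v : 'rV[R]_d) : R := \sum_(i < d) u 0 i * v 0 i.

(* The library norm [`|u|] on row vectors is the sup norm; it is used below only
   through the topology it induces, for which [differentiable] is the usual
   notion on R^d. *)
Definition enorm (u : 'rV[R]_d) : R := Num.sqrt (inner u u).

Definition gradient (g : 'rV[R]_d -> R) (w : 'rV[R]_d) : 'rV[R]_d :=
  \row_(i < d) 'D_(delta_mx 0 i) g w.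

Definition L_smooth (L : R) (g : 'rV[R]_d -> R) : Prop :=
  forall w w' : 'rV[R]_d,
    enorm (gradient g w - gradient g w') <= L * enorm (w - w').

Definition convex_grad (g : 'rV[R]_d -> R) : Prop :=
  forall w w' : 'rV[R]_d, g w - g w' >= inner (gradient g w') (w - w').

Definition is_argmin (g : 'rV[R]_d -> R) (w : 'rV[R]_d) : Prop :=
  forall v : 'rV[R]_d, g w <= g v.

End euclidean.

Section stochastic.
Context {dO dX : measure_display} {Omega : measurableType dO}
  {Xi : measurableType dX} {R : realType} {P : probability Omega R} {d : nat}.

(* [fine] only moves the mean from \bar R to R: it is the mean as soon as
   [f w (xi omega)] is integrable in omega, and 0 when the mean is infinite. *)
Definition objective (xi : {RV P >-> Xi}) (f : 'rV[R]_d -> Xi -> R)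
    (w : 'rV[R]_d) : R :=
  fine 'E_P[fun omega => f w (xi omega)].

Definition stoch_grad (xi : {RV P >-> Xi}) (f : 'rV[R]_d -> Xi -> R)
    (w : 'rV[R]_d) (omega : Omega) : 'rV[R]_d :=
  gradient (f ^~ (xi omega)) w.

End stochastic.

Definition mean_vector (dO : measure_display) (Omega : measurableType dO)
    (R : realType) (P : probability Omega R) (d : nat)
    (G : Omega -> 'rV[R]_d) : 'rV[R]_d :=
  \row_(i < d) fine 'E_P[fun omega => G omega 0 i].

(* Main.v *)
From mathcomp Require Import measurable_realfun ring lra.
Require Import Defs.

Local Open Scope classical_set_scope.
Local Open Scope ring_scope.

(* For a convex L-smooth function h, one gradient step from w applied to
   h - <grad h(v), .>, which is minimal at v, gives
     |grad h(w) - grad h(v)|^2 <= 2 L (h(w) - h(v) - <grad h(v), w - v>).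
   Take h = f(.; xi) and v = wstar, use |a|^2 <= 2 |a - b|^2 + 2 |b|^2, and
   integrate: the mean of the inner product is <grad F(wstar), w - wstar> = 0. *)

Section inner_product.
Context {R : realType} {d : nat}.
Implicit Types u v w : 'rV[R]_d.

Lemma innerC u v : inner u v = inner v u.
Proof. by apply: eq_bigr => i _; rewrite mulrC. Qed.

Lemma innerDl u v w : inner (u + v) w = inner u w + inner v w.
Proof. by rewrite -big_split; apply: eq_bigr => i _; rewrite mxE mulrDl. Qed.

Lemma innerZl (a : R) u v : inner (a *: u) v = a * inner u v.
Proof. by rewrite mulr_sumr; apply: eq_bigr => i _; rewrite mxE mulrA. Qed.

Lemma innerNl u v : inner (- u) v = - inner u v.
Proof. by rewrite -scaleN1r innerZl mulN1r. Qed.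

Lemma innerDr u v w : inner u (v + w) = inner u v + inner u w.
Proof. by rewrite innerC innerDl !(innerC u). Qed.

Lemma innerZr (a : R) u v : inner u (a *: v) = a * inner u v.
Proof. by rewrite innerC innerZl innerC. Qed.

Lemma innerNr u v : inner u (- v) = - inner u v.
Proof. by rewrite innerC innerNl innerC. Qed.

Lemma inner_ge0 u : 0 <= inner u u.
Proof. by apply: sumr_ge0 => i _; rewrite -expr2 sqr_ge0. Qed.

Lemma enorm_sqr u : enorm u ^+ 2 = inner u u.
Proof. by rewrite sqr_sqrtr // inner_ge0. Qed.

(** The square of [u - a *: v] is nonnegative; expand it and divide by [2 * a]. This weighted form
    stands in for Cauchy-Schwarz. *)
Lemma inner_young (a : R) u v : 0 < a ->
  inner u v <= (a^-1 * inner u u + a * inner v v) / 2.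
Proof.
move=> a0; have := inner_ge0 (u - a *: v).
rewrite !(innerDl, innerDr, innerNl, innerNr, innerZl, innerZr) (innerC v u) => h.
have {}h := mulr_ge0 (ltW (divr_gt0 ltr01 a0)) h.
suff -> : (a^-1 * inner u u + a * inner v v) / 2 = inner u v +
  1 / a * (inner u u + - (a * inner u v)
           + (- (a * inner u v) + - (- (a * (a * inner v v))))) / 2 by lra.
by field; rewrite gt_eqF.
Qed.

Lemma inner_sqrD_le u v : inner (u + v) (u + v) <= 2 * inner u u + 2 * inner v v.
Proof.
have := inner_ge0 (u - v).
rewrite !(innerDl, innerDr, innerNl, innerNr) (innerC v u); lra.
Qed.

End inner_product.

Section smooth_convex.
Context {R : realType} {d : nat} {L : R} {g : 'rV[R]_d -> R}.
Context (L0 : 0 < L) (Lg : L_smooth L g) (cg : convex_grad g).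
Implicit Types u v w x : 'rV[R]_d.

(** Apply [inner_young] with weight [L * s] to the gradient increment [D] and [u]: smoothness bounds
    [inner D D] by [(L * s) ^+ 2 * inner u u], so both terms being averaged are at most
    [L * s * inner u u]. *)
Lemma gradient_along_le x u (s : R) : 0 < s ->
  inner (gradient g (x + s *: u)) u <= inner (gradient g x) u + L * s * inner u u.
Proof.
move=> s0; have Ls0 : 0 < L * s by rewrite mulr_gt0.
have := Lg (x + s *: u) x.
rewrite -(@ler_pXn2r _ 2) ?nnegrE ?sqrtr_ge0 //; last first.
  by rewrite mulr_ge0 ?sqrtr_ge0 ?ltW.
rewrite exprMn !enorm_sqr addrAC subrr add0r innerZl innerZr.
set D := gradient g (x + s *: u) - gradient g x => hD.
have := inner_young _ D u Ls0.
have : (L * s)^-1 * inner D D <= L * s * inner u u.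
  rewrite ler_pdivrMl //; apply: le_trans hD _.
  by rewrite le_eqVlt; apply/orP; left; apply/eqP; ring.
rewrite [inner D u]innerDl innerNl; lra.
Qed.

(* Convexity on each of k consecutive steps of length h: the bound on the
   gradient sums to a Riemann sum of L * s, so no integration is needed. *)
Lemma riemann_descent x u (h : R) (k : nat) : 0 < h ->
  g (x + (k%:R * h) *: u) - g x <=
  k%:R * h * inner (gradient g x) u
  + L * inner u u * (k%:R * k.+1%:R * h ^+ 2 / 2).
Proof.
move=> h0; elim: k => [|k IH]; first by rewrite !mul0r scale0r addr0 subrr mulr0 addr0.
have sh : 0 < k.+1%:R * h by rewrite mulr_gt0 ?ltr0n.
have hg := gradient_along_le x u _ sh.
(* The tangent is taken at the right end of the step, so that convexity bounds the increment of [g]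
   from above. The slopes then carry the factors [1, ..., k], whose sum is the [k * (k + 1) / 2] of
   the statement. *)
have := cg (x + (k%:R * h) *: u) (x + (k.+1%:R * h) *: u).
have -> : x + (k%:R * h) *: u - (x + (k.+1%:R * h) *: u) = (- h) *: u.
  by rewrite opprD addrACA subrr add0r -scalerBl -natr1; congr (_ *: _); ring.
rewrite innerZr => hc.
have := ler_wpM2l (ltW h0) hg.
move: IH hc; rewrite -[k.+2%:R]natr1 -[k.+1%:R]natr1.
lra.
Qed.

Lemma descent x u :
  g (x + u) <= g x + inner (gradient g x) u + L / 2 * inner u u.
Proof.
apply/ler_addgt0Pr => e e0.
set B := L / 2 * inner u u.
have B0 : 0 <= B by rewrite mulr_ge0 ?inner_ge0 // divr_ge0 // ltW.
(* With [n] steps of length [1 / n] the Riemann sum equals [B + B / n]; this [n] exceeds [B / e],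
   which makes the excess at most [e]. *)
set n := (Num.truncn (B / e)).+1.
have n0 : 0 < n%:R :> R by rewrite ltr0n.
have Bn : B / n%:R <= e.
  rewrite ler_pdivrMr // mulrC -ler_pdivrMr //.
  exact/ltW/truncnS_gt.
have := riemann_descent x u n%:R^-1 n.
rewrite invr_gt0 => /(_ n0); rewrite divff ?gt_eqF // scale1r mul1r.
have -> : L * inner u u * (n%:R * n.+1%:R * n%:R^-1 ^+ 2 / 2) = B + B / n%:R.
  by rewrite -natr1 /B; field; rewrite gt_eqF.
lra.
Qed.

Lemma cocoercive w v :
  inner (gradient g w - gradient g v) (gradient g w - gradient g v)
  <= 2 * L * (g w - g v - inner (gradient g v) (w - v)).
Proof.
set D := gradient g w - gradient g v.
(* [descent] bounds [g (w - L^-1 *: D)] from above and the tangent at [v] bounds it from below.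
   Comparing the two leaves [inner D D / (2 * L)] on the smaller side. *)
have := descent w (- (L^-1 *: D)).
have := cg (w - L^-1 *: D) v.
rewrite [w - _ - v]addrAC [inner _ (w - v - _)]innerDr !(innerNr _ (_ *: _)).
rewrite innerNl innerZl !innerZr.
have -> : inner (gradient g w) D = inner D D + inner (gradient g v) D.
  by rewrite -innerDl subrK.
set I := inner D D; set J := inner _ D => h1 h2.
have h3 : L^-1 * I / 2 <= g w - g v - inner (gradient g v) (w - v).
  have : L / 2 * - (- (L^-1 * (L^-1 * I))) = L^-1 * I / 2.
    by field; rewrite gt_eqF.
  lra.
have := ler_wpM2l (ltW (mulr_gt0 (ltr0n R 2) L0)) h3.
suff -> : 2 * L * (L^-1 * I / 2) = I by [].
by field; rewrite gt_eqF.
Qed.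

End smooth_convex.

(** Fermat's rule in one variable, applied to the restriction [phi] of [g] to each coordinate line
    through [w]. *)
Lemma gradient_argmin {R : realType} {d : nat} (g : 'rV[R]_d -> R) (w : 'rV[R]_d) :
  (forall v, differentiable g v) -> is_argmin g w -> gradient g w = 0.
Proof.
move=> dg gmin; apply/rowP => i; rewrite !mxE.
set e := delta_mx 0 i.
pose phi (h : R) := g (h *: e + w).
have -> : 'D_e g w = 'D_1 phi 0.
  rewrite /derive /phi; apply: (congr1 (fun q => lim (q @ 0^'))); apply/funext => h /=.
  by rewrite addr0 scale0r add0r [h%:A]mulr1.
have dphi t : derivable phi t 1.
  apply: diff_derivable; apply: differentiable_comp; last exact: dg.
  exact: differentiableD.
have min0 : is_derive (0 : R) (1 : R) phi 0.
  apply: (@derive1_at_min R phi (-1) 1) => //.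
  - by rewrite in_itv /= oppr_lt0 ltr01.
  - by move=> t _; rewrite {1}/phi scale0r add0r; exact: gmin.
by rewrite derive_val.
Qed.

Section expectation.
Context {dO : measure_display} {Omega : measurableType dO} {R : realType}
  {P : probability Omega R} {d : nat} {G : Omega -> 'rV[R]_d}.
Context (iG : forall i, P.-integrable setT (fun omega => (G omega 0 i)%:E)).

Lemma integrable_inner (v : 'rV[R]_d) :
  P.-integrable setT (fun omega => (inner (G omega) v)%:E).
Proof.
under eq_fun do rewrite -sumEFin.
apply: integrable_sum => // i _.
under eq_fun do rewrite mulrC EFinM.
exact: integrableZl.
Qed.

Lemma expectation_inner (v : 'rV[R]_d) :
  ('E_P[fun omega => inner (G omega) v] = (inner (mean_vector P G) v)%:E)%E.
Proof.
rewrite unlock.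
under eq_integral do rewrite -sumEFin.
rewrite integral_sum //; last first.
  move=> i; under eq_fun do rewrite mulrC EFinM.
  exact: integrableZl.
rewrite -sumEFin; apply: eq_bigr => i _.
under eq_integral do rewrite mulrC EFinM.
(* Each component is integrable, so its mean is finite and the [fine] in [mean_vector] loses
   nothing. *)
rewrite integralZl // mxE mulrC EFinM unlock fineK //.
exact: integrable_fin_num.
Qed.

Lemma measurable_enorm_sqr : measurable_fun setT (fun omega => enorm (G omega) ^+ 2).
Proof.
under eq_fun do rewrite enorm_sqr.
apply: measurable_sum => i; apply: measurable_funM;
by apply/measurable_EFinP; exact: measurable_int (iG i).
Qed.

End expectation.

Theorem lemma1 (dO dX : measure_display) (Omega : measurableType dO)
    (Xi : measurableType dX) (R : realType) (P : probability Omega R) (d : nat)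
    (xi : {RV P >-> Xi}) (f : 'rV[R]_d -> Xi -> R) (L : R) (wstar : 'rV[R]_d) :
  let F := objective xi f in
  let g := stoch_grad xi f in
  (forall (omega : Omega) (w : 'rV[R]_d),
     differentiable (f ^~ (xi omega)) w) ->
  (forall w : 'rV[R]_d,
     P.-integrable setT (fun omega => (f w (xi omega))%:E)) ->
  (forall (w : 'rV[R]_d) (i : 'I_d),
     P.-integrable setT (fun omega => (g w omega 0 i)%:E)) ->
  (forall w : 'rV[R]_d, differentiable F w) ->
  (forall w : 'rV[R]_d, mean_vector P (g w) = gradient F w) ->
  0 < L ->
  (forall omega : Omega, L_smooth L (f ^~ (xi omega))) ->
  (forall omega : Omega, convex_grad (f ^~ (xi omega))) ->
  is_argmin F wstar ->
  let N : \bar R :=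
    (2%:E * 'E_P[fun omega => (enorm (g wstar omega) ^+ 2)%R])%E in
  forall w : 'rV[R]_d,
    ('E_P[fun omega => (enorm (g w omega) ^+ 2)%R]
     <= (4 * L * (F w - F wstar))%:E + N)%E.
Proof.
move=> F g _ intf intg dF gF L0 smooth cvx wmin N w.
(* The factor [4 * L] is the [2 * L] of [cocoercive] doubled by [inner_sqrD_le]. *)
pose D omega := 4 * L * (f w (xi omega) - f wstar (xi omega)
                         - inner (g wstar omega) (w - wstar)).
have pointwise omega : enorm (g w omega) ^+ 2 <= D omega + 2 * enorm (g wstar omega) ^+ 2.
  have := cocoercive L0 (smooth omega) (cvx omega) w wstar.
  have := inner_sqrD_le (g w omega - g wstar omega) (g wstar omega).
  rewrite subrK !enorm_sqr /D; lra.
(* The squared norms are not assumed integrable and [N] may be infinite; the sign of [D] allows the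
   integral of the sum to be split all the same. *)
have D_ge0 omega : 0 <= D omega.
  by apply: mulr_ge0; [rewrite mulr_ge0 // ltW|rewrite subr_ge0; exact: cvx].
have iD := integrableB measurableT (intf w) (intf wstar).
have iI := integrable_inner (intg wstar) (w - wstar).
have iDI := integrableB measurableT iD iI.
have DE : (fun omega => (D omega)%:E) = (fun omega =>
    (4 * L)%:E * ((f w (xi omega))%:E - (f wstar (xi omega))%:E
                - (inner (g wstar omega) (w - wstar))%:E))%E by [].
have intD : P.-integrable setT (fun omega => (D omega)%:E).
  rewrite DE; exact: integrableZl.
have meanD : (\int[P]_omega (D omega)%:E = (4 * L * (F w - F wstar))%:E)%E.
  rewrite DE integralZl // integralB // integralB //.
  have := expectation_inner (intg wstar) (w - wstar).
  rewrite unlock => ->.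
  rewrite gF gradient_argmin // /inner big1 ?sube0; last by move=> i _; rewrite mxE mul0r.
  (* Integrability at [w] and [wstar] makes [F] the true mean at both points. *)
  by rewrite [RHS]EFinM EFinB /F /objective unlock !fineK // ?integrable_fin_num.
have mg v := measurable_enorm_sqr (intg v).
have sq0 v omega : (0 <= (enorm (g v omega) ^+ 2)%:E)%E by rewrite lee_fin sqr_ge0.
have mN : measurable_fun setT (fun omega => (2%:E * (enorm (g wstar omega) ^+ 2)%:E)%E).
  by apply: emeasurable_funM => //; apply/measurable_EFinP.
rewrite /N unlock -meanD -ge0_integralZl_EFin //; last exact/measurable_EFinP.
rewrite -ge0_integralD //.
- apply: ge0_le_integral => //.
  + exact/measurable_EFinP.
  + by apply: emeasurable_funD => //; exact: measurable_int intD.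
  + by move=> omega _; rewrite -EFinM -EFinD lee_fin; exact: pointwise.
- by move=> omega _; rewrite lee_fin.
- exact: measurable_int intD.
- by move=> omega _; rewrite mule_ge0.
Qed.
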